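(* Let $n,m,d,k$ be positive integers with $m\mid n$, let $\mathcal{F}$ be a set of $k$-MOFS$(n;n/m)$ and let $\mathcal{F}'$ be the $d$-dilation of $\mathcal{F}$. Then $\mathcal{F}'$ is maximal (i.e. no frequency square of type $(dn;dn/m)$ is orthogonal to every square of $\mathcal{F}'$) if either (1) $d^2\not\equiv 0\pmod m$ and $\mathcal{F}$ is complete, i.e. $k=(n-1)^2/(m-1)$; or (2) $d$ and $n/m$ are both odd, and $\mathcal{F}$ satisfies a Jedwab-Popatia relation.
   Context: A frequency square of type $(n;\lambda)$ is an $n\times n$ array on symbols $N(n/\lambda)=\{0,\dots,n/\lambda-1\}$ in which each symbol occurs $\lambda$ times in each row and each column; two such squares are orthogonal if, superimposed, each ordered pair of symbols occurs $\lambda^2$ times; a set of $k$-MOFS$(n;\lambda)$ is a set of $k$ pairwise orthogonal such squares. The $d$-dilation of a set of $k$-MOFS$(n;n/m)$ is the set of $k$-MOFS$(dn;dn/m)$ obtained by replacing every entry $e$ of every square by a $d\times d$ block all of whose entries equal $e$. For an (ordered) set $\mathcal{F}=\{F_1,\dots,F_k\}$ of $k$-MOFS$(n;\lambda)$, form the $n^2\times(k+2)$ array $\mathcal{O}$ having a row $[i,j,F_1[i,j],\dots,F_k[i,j]]$ for each $i,j\in\{0,\dots,n-1\}$, and let $Y_c$ be the set of symbols occurring in column $c$ of $\mathcal{O}$ ($c=0,\dots,k+1$). A relation is a tuple $(X_0,\dots,X_{k+1})$ with $X_c\subseteq Y_c$ such that every row of $\mathcal{O}$ has an even number of columns $c$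 whose entry lies in $X_c$. A Jedwab-Popatia relation is a relation with $|X_i|=1$ for all $i\ge2$ and such that at least one of $\emptyset\subsetneq X_0\subsetneq Y_0$ and $\emptyset\subsetneq X_1\subsetneq Y_1$ holds. *)

(* Defs.v *)
From mathcomp Require Import all_boot matrix finmap.

Set Implicit Arguments.
Unset Strict Implicit.
Unset Printing Implicit Defensive.

Local Open Scope fset_scope.

(* The counts force l * (n %/ l) = n as soon as 0 < n. *)
Definition freq_square (n l : nat) (F : 'M[nat]_n) : Prop :=
  [/\ forall i j, F i j < n %/ l,
      forall i s, s < n %/ l -> #|[set j | F i j == s]| = l
    & forall j s, s < n %/ l -> #|[set i | F i j == s]| = l].

Definition orthogonal_squares (n l : nat) (F G : 'M[nat]_n) : Prop :=
  forall s t, s < n %/ l -> t < n %/ l ->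
    #|[set p : 'I_n * 'I_n | (F p.1 p.2 == s) && (G p.1 p.2 == t)]| = l ^ 2.

Definition MOFS (k n l : nat) (F : 'I_k -> 'M[nat]_n) : Prop :=
  (forall a, freq_square l (F a)) /\
  (forall a b, a != b -> orthogonal_squares l (F a) (F b)).

Definition maximal_MOFS (k n l : nat) (F : 'I_k -> 'M[nat]_n) : Prop :=
  ~ exists G : 'M[nat]_n,
      freq_square l G /\ forall a, orthogonal_squares l (F a) G.

Lemma block_index_proof (d n : nat) (i : 'I_(d * n)) : i %/ d < n.
Proof.
case: d i => [|d] i; first by case: i.
by rewrite ltn_divLR // (leq_trans (ltn_ord i)) // mulnC.
Qed.

Definition block_index (d n : nat) (i : 'I_(d * n)) : 'I_n :=
  Ordinal (block_index_proof i).

Definition dilation (d n k : nat) (F : 'I_k -> 'M[nat]_n) :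
    'I_k -> 'M[nat]_(d * n) :=
  fun a => (\matrix_(i, j) F a (block_index i) (block_index j))%R.

(* k = (n - 1)^2 / (m - 1) with the denominator cleared. *)
Definition complete_MOFS (m k n : nat) (F : 'I_k -> 'M[nat]_n) : Prop :=
  k * (m - 1) = (n - 1) ^ 2.

(* The rows of the n^2 x (k + 2) array are indexed by the cells (i, j). *)
Definition array_row (k n : nat) (F : 'I_k -> 'M[nat]_n) (i j : 'I_n) :
    k.+2.-tuple nat :=
  [tuple of val i :: val j :: [tuple F a i j | a < k]].

Definition column_symbols (k n : nat) (F : 'I_k -> 'M[nat]_n)
    (c : 'I_k.+2) : {fset nat} :=
  [fset tnth (array_row F p.1 p.2) c | p in {: 'I_n * 'I_n}].

Definition relation (k n : nat) (F : 'I_k -> 'M[nat]_n)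
    (X : 'I_k.+2 -> {fset nat}) : Prop :=
  (forall c, X c `<=` column_symbols F c) /\
  (forall i j, ~~ odd #|[set c | tnth (array_row F i j) c \in X c]|).

Definition column0 (k : nat) : 'I_k.+2 := @Ordinal k.+2 0 isT.
Definition column1 (k : nat) : 'I_k.+2 := @Ordinal k.+2 1 isT.

Definition JedwabPopatia_relation (k n : nat) (F : 'I_k -> 'M[nat]_n)
    (X : 'I_k.+2 -> {fset nat}) : Prop :=
  [/\ relation F X,
      forall c : 'I_k.+2, 2 <= c -> #|` X c| = 1
    & (fset0 `<` X (column0 k)) /\ (X (column0 k) `<` column_symbols F (column0 k)) \/
      (fset0 `<` X (column1 k)) /\ (X (column1 k) `<` column_symbols F (column1 k))].

(* Main.v *)
(** Every column c of the array O is balanced: each of its symbols occurs in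
    n * mu_c rows, where mu_c is 1 for c < 2 and n / m otherwise, and each pair
    of symbols of two distinct columns occurs in mu_c * mu_c' rows.  If G is
    orthogonal to the dilation, let g (i, j) be the number of zeros of G in the
    block (i, j); then g sums to d^2 (n / m) mu_c over the rows of O with a
    given symbol in column c.

    Complete case: fix a cell p and let v(q) be 1 plus the sum over the columns
    c of (N_c [O(q, c) = O(p, c)] - 1), N_c being the number of symbols in
    column c.  The terms are pairwise orthogonal, and completeness says exactly
    that v(p) = n^2 and that the squared norm of v is n^4, so v vanishes off p.
    Pairing v with g gives m g(p) = d^2.

    Relation case: summing any weight over the pairs (row of O, column whose
    entry lies in X_c) gives an even number.  With the indicator of a symbol s
    of column c0 as weight, the parity of the sum of |X_c| over c <> c0 is that
    of n [s in X_c0].  A proper nonempty X_0 or X_1 thus makes n even, and then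
    c0 >= 2 makes the sum of |X_c| over c <> c0 even; the weight g makes the
    full sum even, contradicting |X_c0| = 1. *)
Require Import Defs.
From mathcomp Require Import all_boot matrix finmap.
From mathcomp Require Import all_order all_algebra ring zify.

Set Implicit Arguments.
Unset Strict Implicit.
Unset Printing Implicit Defensive.

Import Order.TTheory GRing.Theory Num.Theory.

(** * Counting in products and blocks *)

Lemma sum1_cardB (T : finType) (P : pred T) :
  \sum_(x : T) (P x : nat) = #|[set x | P x]|.
Proof. by rewrite -big_mkcond sum1_card cardsE. Qed.

Lemma card_pairs_row (T U : finType) (P : pred T) (Q : T -> pred U) (r : nat) :
    (forall i, P i -> #|[set j | Q i j]| = r) ->
  #|[set p : T * U | P p.1 && Q p.1 p.2]| = #|[set i | P i]| * r.
Proof.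
move=> Qr; rewrite -sum1_card (eq_bigl (fun p : T * U => P p.1 && Q p.1 p.2));
  last by move=> p; rewrite inE.
rewrite -(pair_big_dep P Q (fun _ _ => 1)) /= -sum_nat_const.
rewrite [RHS](eq_bigl P) => [|i]; last by rewrite inE.
by apply: eq_bigr => i Pi; rewrite -(Qr i Pi) cardsE sum1_card.
Qed.

Lemma card_pairs_col (T U : finType) (P : pred U) (Q : T -> pred U) (r : nat) :
    (forall j, P j -> #|[set i | Q i j]| = r) ->
  #|[set p : T * U | P p.2 && Q p.1 p.2]| = #|[set j | P j]| * r.
Proof.
move=> Qr; rewrite -(card_pairs_row (Q := fun j i => Q i j) Qr).
have swap_inj : injective (fun p : T * U => (p.2, p.1)) by move=> [? ?] [? ?] [-> ->].
rewrite -(card_imset _ swap_inj); apply: eq_card => -[j i].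
rewrite inE /=; apply/imsetP/idP => [[[i' j']]|PQ].
  by rewrite inE /= => PQ [-> ->].
by exists (i, j); rewrite ?inE.
Qed.

Lemma card_block (d n : nat) (i : 'I_n) :
  #|[set a : 'I_(d * n) | block_index a == i]| = d.
Proof.
have [d0|d_gt0] := posnP d.
  by rewrite d0; apply: eq_card0 => -[].
have lt_f (r : 'I_d) : i * d + r < d * n.
  by have := ltn_ord i; have := ltn_ord r; nia.
pose f (r : 'I_d) := Ordinal (lt_f r).
have f_inj : injective f.
  by move=> r r' [] /addnI /val_inj.
rewrite -[RHS]card_ord -(card_imset 'I_d f_inj); apply: eq_card => a.
rewrite inE; apply/eqP/imsetP => [def_i|[r _ ->]].
  exists (Ordinal (ltn_pmod a d_gt0)) => //.
  by apply: val_inj; rewrite /= -def_i -divn_eq.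
by apply: val_inj; rewrite /= divnMDl // divn_small ?addn0.
Qed.

(** * The columns of the array and their balance *)

Lemma columnP (k : nat) (c : 'I_k.+2) :
  [\/ c = column0 k, c = column1 k | exists a : 'I_k, c = lift ord0 (lift ord0 a)].
Proof.
case: (unliftP ord0 c) => [c' ->|->]; last by apply: Or31; apply: val_inj.
case: (unliftP ord0 c') => [a ->|->]; last by apply: Or32; apply: val_inj.
by apply: Or33; exists a.
Qed.

Definition entry (k n : nat) (F : 'I_k -> 'M[nat]_n) (c : 'I_k.+2)
  (p : 'I_n * 'I_n) : nat := tnth (array_row F p.1 p.2) c.

Lemma entry0 (k n : nat) (F : 'I_k -> 'M[nat]_n) p : entry F (column0 k) p = p.1.
Proof. by []. Qed.

Lemma entry1 (k n : nat) (F : 'I_k -> 'M[nat]_n) p : entry F (column1 k) p = p.2.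
Proof. by []. Qed.

Lemma entryS (k n : nat) (F : 'I_k -> 'M[nat]_n) a p :
  entry F (lift ord0 (lift ord0 a)) p = F a p.1 p.2.
Proof. by rewrite /entry /array_row !tnthS tnth_mktuple. Qed.

Definition entryE := (entry0, entry1, entryS).

Definition level (k n m : nat) (c : 'I_k.+2) : nat := if c < 2 then n else m.

Definition mult (k n m : nat) (c : 'I_k.+2) : nat := if c < 2 then 1 else n %/ m.

Section Array.
Variables (n m d k : nat) (F : 'I_k -> 'M[nat]_n).
Hypotheses (n_gt0 : 0 < n) (m_gt0 : 0 < m) (d_gt0 : 0 < d) (m_dvd_n : m %| n).
Hypothesis F_MOFS : MOFS (n %/ m) F.

Local Notation N := (level n m).
Local Notation mu := (mult n m).
Local Notation entry := (entry F).

Lemma level_mult (c : 'I_k.+2) : N c * mu c = n.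
Proof. by rewrite /level /mult; case: ifP; rewrite ?muln1 // mulnC divnK. Qed.

Lemma divn_mult : n %/ (n %/ m) = m.
Proof. by rewrite divnA // mulKn. Qed.

Lemma ltn_entry c p : entry c p < N c.
Proof.
case: (columnP c) => [->|->|[a ->]]; rewrite entryE ?ltn_ord //.
by case: (F_MOFS.1 a) => + _ _; rewrite divn_mult; apply.
Qed.

Lemma card_ord_eq (s : nat) : s < n -> #|[set i : 'I_n | i == s :> nat]| = 1.
Proof.
move=> lt_sn; rewrite -(cards1 (Ordinal lt_sn)).
by apply: eq_card => i; rewrite !inE.
Qed.

(** The two index columns determine a cell; an index column against a square is the frequency
    condition; two squares are orthogonal. The remaining cases follow by symmetry. *)
Lemma card_entry2 c c' s t : c != c' -> s < N c -> t < N c' ->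
  #|[set p | (entry c p == s) && (entry c' p == t)]| = mu c * mu c'.
Proof.
have sym c1 c2 s1 s2 : #|[set p | (entry c1 p == s1) && (entry c2 p == s2)]| =
                       #|[set p | (entry c2 p == s2) && (entry c1 p == s1)]|.
  by apply: eq_card => p; rewrite !inE andbC.
have row a s1 s2 : s1 < n -> s2 < m ->
    #|[set p | (entry (column0 k) p == s1) &&
               (entry (lift ord0 (lift ord0 a)) p == s2)]| = n %/ m.
  move=> s1n s2m; have [_ rowF _] := F_MOFS.1 a.
  rewrite -[RHS]mul1n -(card_ord_eq s1n).
  rewrite -(@card_pairs_row _ _ _ (fun i j => F a i j == s2)) => [|i _].
    by apply: eq_card => p; rewrite !inE !entryE.
  by apply: rowF; rewrite divn_mult.
have col a s1 s2 : s1 < n -> s2 < m ->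
    #|[set p | (entry (column1 k) p == s1) &&
               (entry (lift ord0 (lift ord0 a)) p == s2)]| = n %/ m.
  move=> s1n s2m; have [_ _ colF] := F_MOFS.1 a.
  rewrite -[RHS]mul1n -(card_ord_eq s1n).
  rewrite -(@card_pairs_col _ _ _ (fun i j => F a i j == s2)) => [|i _].
    by apply: eq_card => p; rewrite !inE !entryE.
  by apply: colF; rewrite divn_mult.
have cell s1 s2 : s1 < n -> s2 < n ->
    #|[set p | (entry (column0 k) p == s1) && (entry (column1 k) p == s2)]| = 1.
  move=> s1n s2n; rewrite -[RHS]mul1n -{1}(card_ord_eq s1n).
  rewrite -(@card_pairs_row _ _ _ (fun i j : 'I_n => j == s2 :> nat)) => [|i _].
    by apply: eq_card => p; rewrite !inE !entryE.
  exact: card_ord_eq.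
case: (columnP c) (columnP c') => [->|->|[a ->]] [->|->|[b ->]] neq sN tN;
  rewrite /mult /= ?mul1n ?muln1 //.
- exact: cell.
- exact: row.
- by rewrite sym cell.
- exact: col.
- by rewrite sym row.
- by rewrite sym col.
rewrite mulnn -(F_MOFS.2 a b _ s t) ?divn_mult //.
  by apply: eq_card => p; rewrite !inE !entryE.
Qed.

(** Column 0 is counted directly; for any other column, [card_entry2] against column 0 is summed
    over the [n] row indices. *)
Lemma card_entry c s : s < N c -> #|[set p | entry c p == s]| = n * mu c.
Proof.
have row (t : nat) : t < n -> #|[set p | entry (column0 k) p == t]| = n.
  move=> tn; rewrite -[RHS]mul1n -{1}(card_ord_eq tn).
  rewrite -(@card_pairs_row _ _ _ (fun _ _ : 'I_n => true)) => [|i _].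
    by apply: eq_card => p; rewrite !inE entryE andbT.
  by rewrite cardsE card_ord.
case: (eqVneq c (column0 k)) => [-> /row ->|c0 sN]; first by rewrite /mult muln1.
have -> : n * mu c = \sum_(i < n) mu (column0 k) * mu c.
  by rewrite sum_nat_const card_ord mul1n.
rewrite -sum1_card (partition_big (fun p => p.1) xpredT) //=.
apply: eq_bigr => i _; rewrite sum1_card -(card_entry2 (s := i) (t := s)) //.
- by apply: eq_card => p; rewrite !inE unfold_in inE /= andbC.
- by rewrite eq_sym.
Qed.

(** * Parity constraints imposed by a relation *)

Section Relation.
Variable X : 'I_k.+2 -> {fset nat}.
Hypothesis X_rel : relation F X.

Lemma ltn_relation c s : s \in X c -> s < N c.
Proof.
by move=> /(fsubsetP (X_rel.1 c)) /imfsetP[p _ ->]; exact: ltn_entry.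
Qed.

(** After exchanging the sums, each [w q] is multiplied by the number of columns whose entry at [q]
    lies in [X c], which is even. *)
Lemma relation_weight (w : 'I_n * 'I_n -> nat) :
  ~~ odd (\sum_c \sum_(q | entry c q \in X c) w q).
Proof.
rewrite (exchange_big_dep xpredT) //=.
elim/big_ind: _ => // [x y /negPf xF /negPf yF|[i j] _]; first by rewrite oddD xF yF.
by rewrite sum_nat_const oddM -cardsE (negPf (X_rel.2 i j)).
Qed.

Lemma sum_weight_const (w : 'I_n * 'I_n -> nat) c r :
    (forall s, s < N c -> \sum_(q | entry c q == s) w q = r) ->
  \sum_(q | entry c q \in X c) w q = #|` X c| * r.
Proof.
move=> wr; transitivity (\sum_(s <- X c) \sum_(q | entry c q == s) w q).
  under [RHS]eq_bigr do rewrite big_mkcond /=.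
  rewrite exchange_big big_mkcond /=; apply: eq_bigr => q _.
  have [qX|qX] := boolP (entry c q \in X c).
    rewrite (bigD1_seq (entry c q)) ?fset_uniq //= eqxx.
    by rewrite big1 ?addn0 // => s; rewrite eq_sym => /negPf ->.
  by rewrite big1_seq // => s /= sX; case: eqP => // eq_s; rewrite eq_s sX in qX.
rewrite big_seq (eq_bigr (fun=> r)) => [|s /ltn_relation]; last exact: wr.
by rewrite -big_seq big_const_seq count_predT iter_addn_0 mulnC.
Qed.

Hypothesis odd_nm : odd (n %/ m).

Lemma odd_mult (c : 'I_k.+2) : odd (mu c).
Proof. by rewrite /mult; case: ifP. Qed.

Lemma relation_parity c0 s0 : s0 < N c0 ->
  odd (\sum_(c | c != c0) #|` X c|) = (s0 \in X c0) && odd n.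
Proof.
move=> s0N.
have := relation_weight (fun q => entry c0 q == s0 : nat).
rewrite (bigD1 c0) //= oddD.
have -> : odd (\sum_(q | entry c0 q \in X c0) (entry c0 q == s0)) =
          (s0 \in X c0) && odd n.
  have [s0X|s0X] := boolP (s0 \in X c0); last first.
    rewrite big1 // => q qX; case: eqP => // eq_s0.
    by rewrite -eq_s0 qX in s0X.
  have -> : odd n = odd #|[set q | entry c0 q == s0]|.
    by rewrite (card_entry s0N) oddM odd_mult andbT.
  rewrite -sum1_cardB big_mkcond; congr odd; apply: eq_bigr => q _.
  by case: ifPn => //; case: eqP => // ->; rewrite s0X.
have -> : odd (\sum_(c | c != c0) \sum_(q | entry c q \in X c) (entry c0 q == s0)) =
          odd (\sum_(c | c != c0) #|` X c|).
  (* Taking parity inside the sum allows the odd factors [mu c * mu c0] to be dropped term by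
     term. *)
  rewrite !(big_morph odd oddD (erefl : odd 0 = false)); apply: eq_bigr => c neq.
  rewrite (@sum_weight_const _ c (mu c * mu c0)) ?oddM ?odd_mult ?andbT // => s sN.
  rewrite -(card_entry2 neq sN s0N) -sum1_cardB big_mkcond.
  by apply: eq_bigr => q _; case: eqP.
by rewrite addbC; case: (odd _) (_ && _) => -[].
Qed.

(** Compare a symbol inside [X c0] with one outside: the left side of [relation_parity] is the same
    for both. *)
Lemma relation_even c0 : (fset0 `<` X c0)%fset ->
  (X c0 `<` column_symbols F c0)%fset -> ~~ odd n.
Proof.
rewrite fproper0 => /fset0Pn[s1 s1X].
rewrite fproperE => /andP[_ /fsubsetPn[s2 /imfsetP[p _ s2E] s2X]].
have s2N : s2 < N c0 by rewrite s2E; exact: ltn_entry.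
have := relation_parity s2N; rewrite (relation_parity (ltn_relation s1X)).
by rewrite s1X (negPf s2X) => /= ->.
Qed.

End Relation.

(** * Zeros of a square orthogonal to the dilation *)

Section Weight.
Variable G : 'M[nat]_(d * n).
Hypothesis G_freq : freq_square ((d * n) %/ m) G.
Hypothesis G_orth : forall a, orthogonal_squares ((d * n) %/ m) (dilation d F a) G.

Definition block_zeros (q : 'I_n * 'I_n) : nat :=
  #|[set p | (G p.1 p.2 == 0) && ((block_index p.1, block_index p.2) == q)]|.

Lemma divn_dilation : (d * n) %/ ((d * n) %/ m) = m.
Proof. by rewrite divnA ?dvdn_mull // mulKn // muln_gt0 d_gt0. Qed.

(** For an index column, the zeros lie in [d] full rows or columns of [G], each with [d * (n %/ m)]
    of them; for a square, orthogonality with its dilation gives [(d * (n %/ m)) ^ 2]. *)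
Lemma sum_block_zeros c s : s < N c ->
  \sum_(q | entry c q == s) block_zeros q = d ^ 2 * (n %/ m) * mu c.
Proof.
move=> sN; have [_ rowG colG] := G_freq.
pose bl (p : 'I_(d * n) * 'I_(d * n)) := (block_index p.1, block_index p.2).
have -> : \sum_(q | entry c q == s) block_zeros q =
          #|[set p | (entry c (bl p) == s) && (G p.1 p.2 == 0)]|.
  rewrite -[RHS]sum1_card (partition_big bl (fun q => entry c q == s)) /=; last first.
    by move=> p; rewrite inE => /andP[].
  apply: eq_bigr => q cq; rewrite sum1_card; apply: eq_card => p.
  rewrite !inE unfold_in inE /= -/(bl p).
  by case: (bl p =P q) => [->|_]; rewrite ?cq ?andbF ?andbT.
have cardb i : i < n -> #|[set a : 'I_(d * n) | block_index a == i :> nat]| = d.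
  move=> lt_in; rewrite -[RHS](card_block d (Ordinal lt_in)).
  by apply: eq_card => a; rewrite !inE.
have dnm : (d * n) %/ m = d * (n %/ m) by rewrite muln_divA.
case: (columnP c) sN => [->|->|[a ->]] sN; rewrite /mult /= ?muln1.
- transitivity (#|[set a : 'I_(d * n) | block_index a == s :> nat]| * ((d * n) %/ m)).
    2: by rewrite cardb // dnm; lia.
  rewrite -(@card_pairs_row _ _ _ (fun i j => G i j == 0)) // => i _.
  by apply: rowG; rewrite divn_dilation.
- transitivity (#|[set a : 'I_(d * n) | block_index a == s :> nat]| * ((d * n) %/ m)).
    2: by rewrite cardb // dnm; lia.
  rewrite -(@card_pairs_col _ _ _ (fun i j => G i j == 0)) // => i _.
  by apply: colG; rewrite divn_dilation.
rewrite -mulnA mulnn -expnMn -dnm -(G_orth a (s := s) (t := 0)) ?divn_dilation //.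
by apply: eq_card => p; rewrite !inE entryE mxE.
Qed.

Lemma sum_block_zeros_all : \sum_q block_zeros q = n * (d ^ 2 * (n %/ m)).
Proof.
rewrite (partition_big (fun q => q.1) xpredT) //=.
rewrite (eq_bigr (fun=> d ^ 2 * (n %/ m))) ?sum_nat_const ?card_ord // => i _.
by rewrite -[RHS]muln1 -(@sum_block_zeros (column0 k) i).
Qed.

Lemma dilation_odd_relation (X : 'I_k.+2 -> {fset nat}) : 0 < k ->
  odd d -> odd (n %/ m) -> ~ JedwabPopatia_relation F X.
Proof.
move=> k_gt0 odd_d odd_nm [X_rel X1 proper].
have n_even : ~~ odd n.
  by case: proper => -[]; exact: relation_even.
(* The column of the first square, which exists because [k] is positive. *)
pose c0 : 'I_k.+2 := lift ord0 (lift ord0 (Ordinal k_gt0)).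
have N_gt0 : 0 < N c0 by [].
have := relation_parity X_rel odd_nm N_gt0; rewrite (negPf n_even) andbF.
have : ~~ odd (\sum_c #|` X c|).
  apply: contra (relation_weight X_rel block_zeros).
  rewrite !(big_morph odd oddD (erefl : odd 0 = false)).
  apply: etrans; apply: eq_bigr => c _.
  rewrite (sum_weight_const X_rel (@sum_block_zeros c)).
  by rewrite !oddM odd_d odd_nm odd_mult //= andbT.
by rewrite (bigD1 c0) //= X1 // oddD /= => /negPn ->.
Qed.

Local Open Scope ring_scope.

Lemma dvdn_complete : complete_MOFS m F -> (m %| d ^ 2)%N.
Proof.
(* Any cell would do for [p]. Integers are used because [u] takes negative values. *)
move=> F_complete; pose p := (Ordinal n_gt0, Ordinal n_gt0).
pose del c q : int := (entry c q == entry c p)%:R.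
pose u c q : int := (N c)%:R * del c q - 1.
pose v q : int := 1 + \sum_c u c q.
have level_multR (c : 'I_k.+2) : (N c)%:R * (mu c)%:R = n%:R :> int by rewrite -natrM level_mult.
have sum_bool (P : pred ('I_n * 'I_n)) :
    \sum_q (P q)%:R = #|[set q | P q]|%:R :> int.
  by rewrite -natr_sum sum1_cardB.
have sum_one : \sum_(q : 'I_n * 'I_n) 1 = n%:R ^+ 2 :> int.
  by rewrite sumr_const card_prod card_ord natrM expr2.
have sum_del c : \sum_q del c q = n%:R * (mu c)%:R.
  by rewrite sum_bool card_entry ?ltn_entry // natrM.
have sum_del2 c c' : c != c' -> \sum_q del c q * del c' q = (mu c)%:R * (mu c')%:R.
  move=> neq; rewrite -natrM -(card_entry2 neq (ltn_entry c p) (ltn_entry c' p)).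
  by rewrite -sum_bool; apply: eq_bigr => q _; rewrite /del -natrM mulnb.
have sum_u c : \sum_q u c q = 0.
  rewrite sumrB -mulr_sumr sum_del sum_one mulrCA level_multR; ring.
have sum_u2 c c' : \sum_q u c q * u c' q =
    if c == c' then n%:R ^+ 2 * ((N c)%:R - 1) else 0.
  rewrite (eq_bigr (fun q => (N c)%:R * (N c')%:R * (del c q * del c' q)
    - (N c)%:R * del c q - (N c')%:R * del c' q + 1)); last first.
    by move=> q _; rewrite /u; ring.
  rewrite big_split /= !sumrB -!mulr_sumr !sum_del sum_one.
  have := level_multR c; have := level_multR c'.
  case: eqVneq => [<-|neq] e' e; last first.
    rewrite sum_del2 //.
    transitivity (((N c)%:R * (mu c)%:R - n%:R) * ((N c')%:R * (mu c')%:R - n%:R) : int).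
      ring.
    by rewrite e subrr mul0r.
  rewrite (eq_bigr (del c)) ?sum_del => [|q _].
    by rewrite -e; ring.
  by rewrite /del -natrM mulnb andbb.
(* The index columns give [2(n - 1)] and, by completeness, the squares give
   [k(m - 1) = (n - 1)^2]. *)
have sum_level : \sum_(c : 'I_k.+2) ((N c)%:R - 1) = n%:R ^+ 2 - 1 :> int.
  have kE : k%:R * (m%:R - 1) = (n%:R - 1) ^+ 2 :> int.
    by rewrite -(natrB _ m_gt0) -(natrB _ n_gt0) -natrM -natrX F_complete.
  rewrite !big_ord_recl /= sumr_const card_ord /level /= -[_ *+ k]mulr_natl kE.
  ring.
have vp : v p = n%:R ^+ 2.
  rewrite /v (eq_bigr (fun c => (N c)%:R - 1)) ?sum_level => [|c _]; first ring.
  by rewrite /u /del eqxx mulr1.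
(* The cross terms vanish, leaving [n^2 + n^2 (n^2 - 1) = n^4], so the cell [p] alone accounts for
   the whole norm. *)
have sum_v2 : \sum_q v q ^+ 2 = v p ^+ 2.
  rewrite (eq_bigr (fun q => 1 + 2 * (\sum_c u c q)
      + \sum_c \sum_c' u c q * u c' q)) => [|q _].
    rewrite !big_split /= sum_one -mulr_sumr exchange_big /= big1 // exchange_big /=.
    rewrite (eq_bigr (fun c => n%:R ^+ 2 * ((N c)%:R - 1))) => [|c _].
      by rewrite -mulr_sumr sum_level vp; ring.
    rewrite exchange_big (bigD1 c) //= sum_u2 eqxx big1 ?addr0 // => c' /negPf neq.
    by rewrite sum_u2 eq_sym neq.
  rewrite -big_distrlr /= /v; ring.
have v0 q : q != p -> v q = 0.
  move=> qp; move: sum_v2; rewrite (bigD1 p) //= => /eqP.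
  rewrite -subr_eq0 addrAC subrr add0r psumr_eq0 => [/allP /(_ q)|? _].
    by rewrite mem_index_enum qp sqrf_eq0 => /(_ isT) /eqP.
  exact: sqr_ge0.
have sum_gdel c : \sum_q (block_zeros q)%:R * del c q =
    (d ^ 2 * (n %/ m))%:R * (mu c)%:R :> int.
  rewrite -natrM -(sum_block_zeros (ltn_entry c p)) natr_sum [RHS]big_mkcond.
  by apply: eq_bigr => q _; rewrite /del; case: eqP; rewrite ?mulr1 ?mulr0.
(* Each [u c] is orthogonal to [block_zeros], so only the constant term 1 of [v] contributes. *)
have sum_gv : \sum_q (block_zeros q)%:R * v q = (n * (d ^ 2 * (n %/ m)))%:R :> int.
  rewrite -sum_block_zeros_all natr_sum /v.
  rewrite (eq_bigr (fun q => (block_zeros q)%:R + \sum_c (block_zeros q)%:R * u c q)).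
    rewrite big_split exchange_big /= [X in _ + X]big1 ?addr0 // => c _.
    rewrite /u (eq_bigr (fun q => (N c)%:R * ((block_zeros q)%:R * del c q)
      - (block_zeros q)%:R)) => [|q _]; last ring.
    rewrite sumrB -mulr_sumr sum_gdel mulrCA level_multR -natr_sum.
    by rewrite sum_block_zeros_all -natrM mulnC subrr.
  by move=> q _; rewrite mulrDr mulr1 mulr_sumr.
move: sum_gv; rewrite (bigD1 p) //= big1 ?addr0 => [|q /v0 ->]; last by rewrite mulr0.
rewrite vp -natrX -natrM => /eqP; rewrite eqr_nat => /eqP eq_g.
apply/dvdnP; exists (block_zeros p).
(* Cancel [n * (n %/ m)] in [n^2 g(p) = n d^2 (n / m)], where [g] is [block_zeros]. *)
have := divnK m_dvd_n; nia.
Qed.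

End Weight.
End Array.

Theorem theorem2p5 (n m d k : nat) (F : 'I_k -> 'M[nat]_n)
    (n_gt0 : 0 < n) (m_gt0 : 0 < m) (d_gt0 : 0 < d) (k_gt0 : 0 < k)
    (m_dvd_n : m %| n) (F_MOFS : MOFS (n %/ m) F) :
  (d ^ 2 <> 0 %[mod m] /\ complete_MOFS m F) \/
  [/\ odd d, odd (n %/ m)
    & exists X : 'I_k.+2 -> {fset nat}, JedwabPopatia_relation F X] ->
  maximal_MOFS ((d * n) %/ m) (dilation d F).
Proof.
move=> hyp [G [G_freq G_orth]].
case: hyp => [[not_dvd F_complete]|[odd_d odd_nm [X X_JP]]].
  apply: not_dvd; apply/eqP; rewrite mod0n.
  exact: (dvdn_complete n_gt0 m_gt0 d_gt0 m_dvd_n F_MOFS G_freq G_orth F_complete).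
exact: (dilation_odd_relation n_gt0 m_gt0 d_gt0 m_dvd_n F_MOFS G_freq G_orth
  k_gt0 odd_d odd_nm X_JP).
Qed.
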